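(* Let $X$ be a real inner-product space with induced norm $\|\cdot\|$ and inner product written $u^\top v$. Let $L>0$, let $f:X\to\mathbb{R}$ be convex and $L$-Lipschitz continuously differentiable, and let $\psi:X\to\mathbb{R}\cup\{+\infty\}$ be convex, proper and closed. Put $F=f+\psi$, and assume that the solution set $\Omega=\arg\min_{x\in X}F(x)$ is nonempty, with $F^*=\min_{x\in X} F(x)$. Let $\bar L\ge L$, let $x_0\in X$ be the initial point, and let $(x_k)_{k\ge0}$ be generated by the proximal gradient method $$x_{k+1}=x_k+d_k,\qquad d_k=\arg\min_{d\in X}\ \nabla f(x_k)^\top d+\frac{\bar L}{2}\|d\|^2+\psi(x_k+d),\qquad k=0,1,2,\dots.$$ Then $F(x_k)$ converges to $F^*$ at rate $o(1/k)$, that is, $\lim_{k\to\infty}k\,(F(x_k)-F^* )=0$.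
   Context: A function $f:X\to\mathbb{R}$ is $L$-Lipschitz continuously differentiable if it is differentiable with gradient $\nabla f(x)\in X$ at every $x\in X$ (the vector representing the derivative through the inner product) and $\|\nabla f(x)-\nabla f(y)\|\le L\|x-y\|$ for all $x,y\in X$. It is a standing assumption that $\psi$ is such that the proximal problem $\min_{x}\psi(x)+\frac{1}{2\lambda}\|x-y\|^2$ can be solved for every $y\in X$ and $\lambda>0$; in particular the minimizer $d_k$ exists, and it is unique by strong convexity. *)

(* Defs.v *)
From HB Require Import structures.
From mathcomp Require Import all_boot all_order all_algebra.
From mathcomp Require Import sesquilinear.
From mathcomp Require Import all_classical all_reals all_analysis.

Set Implicit Arguments.
Unset Strict Implicit.
Unset Printing Implicit Defensive.

Import Order.TTheory GRing.Theory Num.Theory.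
Import numFieldNormedType.Exports.

Local Open Scope classical_set_scope.
Local Open Scope ring_scope.

(* A real inner-product space (not assumed complete) is a normed space X with
   a symmetric positive definite bilinear form dot that induces its norm. *)
Definition induces_norm (R : realType) (X : normedModType R)
    (dot : {dot X for idfun}) : Prop :=
  forall u : X, `|u| = Num.sqrt (dot u u).

(* In an incomplete space the derivative need not be represented by a vector,
   so the existence of the gradient is part of the condition. *)
Definition is_gradient (R : realType) (X : normedModType R)
    (dot : {dot X for idfun}) (f : X -> R) (x g : X) : Prop :=
  differentiable (f : X -> R^o) x /\
  forall v : X, 'd (f : X -> R^o) x v = dot g v.

Definition lipschitz_differentiable (R : realType) (X : normedModType R)
    (dot : {dot X for idfun}) (L : R) (f : X -> R) (grad : X -> X) : Prop :=
  (forall x, is_gradient dot f x (grad x)) /\ L.-lipschitz grad.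

Section extended_real_valued.
Context {R : realType} {X : normedModType R}.
Implicit Types psi G : X -> \bar R.
Local Open Scope ereal_scope.

(* Meant for functions that never take the value -oo; since 0 * +oo = 0, the
   endpoints t = 0 and t = 1 impose nothing. *)
Definition convex_efun psi : Prop :=
  forall (x y : X) (t : R), (0 <= t <= 1)%R ->
    psi (t *: x + (1 - t) *: y)%R <= t%:E * psi x + (1 - t)%:E * psi y.

Definition proper_efun psi : Prop :=
  (forall x, psi x != -oo) /\ exists x, psi x != +oo.

Definition epigraph psi : set (X * R) := [set p | psi p.1 <= p.2%:E].

Definition closed_efun psi : Prop := closed (epigraph psi).

Definition argmin G : set X := [set x | forall y, G x <= G y].

Definition is_min G (m : \bar R) : Prop := range G m /\ lbound (range G) m.

Definition prox_solvable psi : Prop :=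
  forall (y : X) (lambda : R), (0 < lambda)%R ->
    argmin (fun x => psi x + ((2 * lambda)^-1 * `|x - y| ^+ 2)%:E) !=set0.

End extended_real_valued.

(* x_{k+1} = x_k + d_k; the step d_k is determined by the membership below, as
   the subproblem is strongly convex. *)
Definition proximal_gradient (R : realType) (X : normedModType R)
    (dot : {dot X for idfun}) (grad : X -> X) (psi : X -> \bar R) (Lbar : R)
    (x0 : X) (x d : nat -> X) : Prop :=
  [/\ x 0%N = x0,
      forall k, x k.+1 = x k + d k &
      forall k, argmin
        (fun v : X => (dot (grad (x k)) v + Lbar / 2 * `|v| ^+ 2)%:E
                      + psi (x k + v)%R)%E (d k)].

(* Main.v *)
(* Comparing d_k with the points t w + (1 - t) d_k and letting t -> 0 gives the
   three-point inequality; combined with the descent lemma and the tangent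
   inequality for f it yields, for every z in the domain of psi,
     F(x_{k+1}) + Lbar/2 |x_{k+1} - z|^2 <= F(z) + Lbar/2 |x_k - z|^2.
   With z = x_k the gaps e_k = F(x_{k+1}) - F* decrease; with z a minimizer,
   e_k <= r_k - r_{k+1} for r_k = Lbar/2 |x_k - z|^2.  Summing the latter from
   k/2 to k bounds (k+1) e_k by 2 (r_{k/2} - r_{k+1}), which tends to 0 because
   r converges. *)
Require Import Defs.
From HB Require Import structures.
From mathcomp Require Import all_boot all_order all_algebra.
From mathcomp Require Import sesquilinear.
From mathcomp Require Import all_classical all_reals all_analysis.
From mathcomp Require Import ring lra.

Set Implicit Arguments.
Unset Strict Implicit.
Unset Printing Implicit Defensive.

Import Order.TTheory GRing.Theory Num.Theory.
Import numFieldNormedType.Exports.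

Local Open Scope classical_set_scope.
Local Open Scope ring_scope.

(** * Inner-product identities and the Cauchy-Schwarz inequality *)

Section inner_product.
Context {R : realType} {X : normedModType R} (dot : {dot X for idfun}).
Hypothesis dot_norm : induces_norm dot.
Implicit Types (u v w : X) (t : R).

Lemma dotC u v : dot u v = dot v u.
Proof. by rewrite hermC expr0 mul1r. Qed.

Lemma dotZl t u v : dot (t *: u) v = t * dot u v.
Proof. exact: linearZl_LR. Qed.

Lemma dotZr t u v : dot u (t *: v) = t * dot u v.
Proof. exact: linearZr_LR. Qed.

Lemma dotDl u v w : dot (u + v) w = dot u w + dot v w.
Proof. exact: linearDl. Qed.

Lemma dotDr u v w : dot u (v + w) = dot u v + dot u w.
Proof. exact: linearDr. Qed.

Lemma dotBl u v w : dot (u - v) w = dot u w - dot v w.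
Proof. exact: linearBl. Qed.

Lemma dotBr u v w : dot u (v - w) = dot u v - dot u w.
Proof. exact: linearBr. Qed.

Lemma dotuu u : dot u u = `|u| ^+ 2.
Proof.
rewrite dot_norm sqr_sqrtr//.
by have [->|/neq0_dnorm_gt0/ltW//] := eqVneq u 0; rewrite linear0r.
Qed.

(** With [a = |u|], [b = |v|], [c = dot u v], expanding [|b u - a v|^2 >= 0] gives
    [2ab(ab - c) >= 0]; zero vectors are split off so that [ab] can be cancelled. *)
Lemma dot_le_norm u v : dot u v <= `|u| * `|v|.
Proof.
have [->|v0] := eqVneq v 0; first by rewrite linear0r normr0 mulr0.
have [->|u0] := eqVneq u 0; first by rewrite linear0l normr0 mul0r.
have : 0 <= `| `|v| *: u - `|u| *: v | ^+ 2 by rewrite sqr_ge0.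
rewrite -dotuu dotBl !dotBr !dotZl !dotZr !dotuu (dotC v u).
move: v0 u0; rewrite -!normr_gt0; move: `|u| `|v| (dot u v) => a b c b0 a0 h.
have ab0 : 0 < a * b by rewrite mulr_gt0.
suff : 0 <= (a * b) * (a * b - c) by rewrite pmulr_rge0// subr_ge0.
lra.
Qed.

(** The strong convexity of the squared norm as an identity; its last term becomes the [|w - d|^2]
    gain in the three-point inequality. *)
Lemma norm_convex_combination t u v :
  `|t *: u + (1 - t) *: v| ^+ 2 =
  t * `|u| ^+ 2 + (1 - t) * `|v| ^+ 2 - t * (1 - t) * `|u - v| ^+ 2.
Proof.
rewrite -!dotuu dotBl !dotDl !dotBr !dotDr.
rewrite !dotZl !dotZr (dotC v u).
ring.
Qed.

End inner_product.

(** * First-order bounds on the smooth part: tangent below, quadratic above *)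

Section smooth_function.
Context {R : realType} {X : normedModType R} (dot : {dot X for idfun}).
Hypothesis dot_norm : induces_norm dot.
Variables (f : X -> R) (grad : X -> X) (L : R).
Hypothesis f_grad : forall x, is_gradient dot f x (grad x).
Implicit Types (x v z : X) (t : R).

Lemma is_derive_grad x v : is_derive x v (f : X -> R^o) (dot (grad x) v).
Proof.
have [df df_dot] := f_grad x.
by apply: DeriveDef; [exact: diff_derivable|rewrite deriveE].
Qed.

Lemma is_derive_line x v t :
  is_derive t (1 : R) (fun s : R => f (x + s *: v)) (dot (grad (x + t *: v)) v).
Proof.
(* Along the line both difference quotients coincide, so no chain rule is needed. *)
have quotE : (fun h : R => h^-1 *: (((fun s : R => f (x + s *: v) : R^o) \o shift t)
      (h *: 1) - f (x + t *: v))) =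
    (fun h : R => h^-1 *: (((f : X -> R^o) \o shift (x + t *: v)) (h *: v) -
      f (x + t *: v))).
  apply/funext => h /=.
  by rewrite [h *: 1]mulr1 scalerDl addrCA.
have [dfv <-] := is_derive_grad (x + t *: v) v.
apply: DeriveDef; first by rewrite /derivable quotE.
by rewrite /derive quotE.
Qed.

(** By convexity, for [0 < h <= 1] the difference quotient of [f] at [x] along [z - x] is at most
    [f z - f x]; the bound survives the limit from the right. *)
Lemma convex_ge_tangent x z : convex_function setT f ->
  f x + dot (grad x) (z - x) <= f z.
Proof.
move=> f_conv; rewrite -lerBrDl.
have [df <-] := is_derive_grad x (z - x).
rewrite /derive -(cvg_lim _ (cvg_dnbhs_at_right df))//.
apply: limr_le; first by apply/cvg_ex; eexists; exact: cvg_dnbhs_at_right df.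
near=> h.
have h0 : 0 < h by near: h; exact: nbhs_right_gt.
have h1 : h <= 1 by near: h; exact: nbhs_right_le.
have : f (h *: z + (1 - h) *: x) <= h * f z + (1 - h) * f x.
  exact: f_conv (Itv01 (ltW h0) h1) z x (mem_set I) (mem_set I).
have -> : h *: z + (1 - h) *: x = h *: (z - x) + x.
  by rewrite scalerBl scale1r scalerBr -addrA [- _ + _]addrC addrA addrAC.
move=> le_conv; rewrite [_ *: _]mulrC ler_pdivrMr// lerBlDr.
by apply: (le_trans le_conv); rewrite le_eqVlt; apply/orP; left; apply/eqP; ring.
Unshelve. all: by end_near. Qed.

Lemma descent_lemma x v : L.-lipschitz grad ->
  f (x + v) <= f x + dot (grad x) v + L / 2 * `|v| ^+ 2.
Proof.
move=> grad_lip.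
(* [g] is [f] along the segment minus the linear term and quadratic bound. Cauchy-Schwarz and the
   Lipschitz condition make its derivative nonpositive, so [g 1 <= g 0] replaces an integration of
   the gradient. *)
pose g (s : R) :=
  f (x + s *: v) - (s * dot (grad x) v + L / 2 * `|v| ^+ 2 * s ^+ 2).
have dg t : is_derive t (1 : R) g
    (dot (grad (x + t *: v)) v - (dot (grad x) v + L * `|v| ^+ 2 * t)).
  have fl := is_derive_line x v t.
  apply: is_derive_eq.
  by rewrite /GRing.scale/=; field.
have g'_le0 t : 0 <= t ->
    dot (grad (x + t *: v)) v - (dot (grad x) v + L * `|v| ^+ 2 * t) <= 0.
  move=> t0; rewrite opprD addrA -dotBl subr_le0.
  apply: (le_trans (dot_le_norm dot_norm _ _)).
  have /= := @grad_lip (x + t *: v, x) (conj I I).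
  rewrite [x + _]addrC addrK normrZ ger0_norm// => /(ler_wpM2r (normr_ge0 v)).
  by move=> /le_trans; apply; rewrite le_eqVlt; apply/orP; left; apply/eqP; ring.
have g_cont : {within `[0, 1], continuous g}.
  by apply: derivable_within_continuous => t _; case: (dg t).
have : g 1 <= g 0.
  apply: (@ler0_derive1_le_cc R g 0 1) => //; rewrite ?in_itv/= ?lexx ?ler01//.
    move=> t /=; rewrite in_itv/= => /andP[/ltW/g'_le0 ? _].
    by rewrite derive1E; case: (dg t) => _ ->.
rewrite /g scale1r scale0r addr0 expr1n expr0n/= !mulr1 mulr0 mul0r mul1r addr0.
by rewrite subr0 lerBlDr addrA.
Qed.

End smooth_function.

(** This is the passage [t -> 0] in the three-point inequality. For a tolerance [e > 0],
    [t = e / (c + e + 1)] gives [t * c <= e]; the summand 1 keeps [t < 1] even if [c = 0]. *)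
Lemma ler_lim_convex_slack (R : realFieldType) (a b c : R) : 0 <= c ->
  (forall t, 0 < t < 1 -> a + (1 - t) * c <= b) -> a + c <= b.
Proof.
move=> c0 slack; apply/ler_addgt0Pr => e e0.
have d0 : 0 < c + e + 1 by lra.
pose t := e / (c + e + 1).
have tE : t * (c + e + 1) = e by rewrite /t divfK// gt_eqF.
have t0 : 0 < t by rewrite divr_gt0.
have t1 : t < 1 by rewrite /t ltr_pdivrMr//; lra.
have := slack t; rewrite t0 t1 => /(_ isT).
have : 0 <= t * (e + 1) by rewrite mulr_ge0//; lra.
lra.
Qed.

(** * Inequalities for one proximal gradient step *)

Section proximal_step.
Context {R : realType} {X : normedModType R} (dot : {dot X for idfun}).
Hypothesis dot_norm : induces_norm dot.
Variable psi : X -> \bar R.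
Hypothesis psi_convex : convex_efun psi.
Implicit Types (x g d w z : X) (M a b : R).

Lemma prox_three_point M g x d w a b : 0 <= M ->
  argmin (fun v => (dot g v + M / 2 * `|v| ^+ 2)%:E + psi (x + v)%R)%E d ->
  psi (x + d) = a%:E -> psi (x + w) = b%:E ->
  dot g d + M / 2 * `|d| ^+ 2 + a + M / 2 * `|w - d| ^+ 2 <=
  dot g w + M / 2 * `|w| ^+ 2 + b.
Proof.
move=> M0 d_min psid psiw; apply: ler_lim_convex_slack.
  by rewrite mulr_ge0// ?divr_ge0// sqr_ge0.
move=> t /andP[t0 t1].
have t01 : 0 <= t <= 1 by rewrite !ltW.
have psi_le : (psi (x + (t *: w + (1 - t) *: d))%R <= (t * b + (1 - t) * a)%:E)%E.
  have -> : x + (t *: w + (1 - t) *: d) = t *: (x + w) + (1 - t) *: (x + d).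
    by rewrite !scalerDr addrACA -scalerDl [t + _]addrC subrK scale1r.
  by rewrite EFinD !EFinM -psid -psiw; exact: psi_convex.
have /= := d_min (t *: w + (1 - t) *: d).
rewrite psid => /le_trans/(_ (leeD2l _ psi_le)).
rewrite -!EFinD lee_fin dotDr !dotZr (norm_convex_combination dot_norm) => le_tw.
(* Subtracting [1 - t] times the objective at [d] from both sides of [le_tw] leaves exactly [t]
   times the goal. *)
rewrite -(ler_pM2l t0).
lra.
Qed.

Lemma argmin_prox_fin_num M g x d w : (forall z, psi z != -oo%E) ->
  argmin (fun v => (dot g v + M / 2 * `|v| ^+ 2)%:E + psi (x + v)%R)%E d ->
  psi (x + w) \is a fin_num -> psi (x + d) \is a fin_num.
Proof.
move=> psiNoo d_min psiw; have /= := d_min w.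
rewrite fin_numE psiNoo/=; move: psiw.
by case: (psi (x + w)) => // b _; case: (psi (x + d)).
Qed.

Lemma prox_gradient_decrease (L M : R) (f : X -> R) (grad : X -> X) x d z a b :
  0 <= M -> L <= M -> convex_function setT f ->
  lipschitz_differentiable dot L f grad ->
  argmin (fun v => (dot (grad x) v + M / 2 * `|v| ^+ 2)%:E + psi (x + v)%R)%E d ->
  psi (x + d) = a%:E -> psi z = b%:E ->
  f (x + d) + a + M / 2 * `|x + d - z| ^+ 2 <= f z + b + M / 2 * `|x - z| ^+ 2.
Proof.
move=> M0 LM f_convex [f_grad grad_lip] d_min psid psiz.
(* The competitor is the step [w = z - x], which lands on [z]. In the final sum the gradient terms
   cancel, and [L <= M] absorbs the quadratic term of the descent lemma. *)
have psiz' : psi (x + (z - x)) = b%:E by rewrite addrCA subrr addr0.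
have := prox_three_point M0 d_min psid psiz'.
rewrite [`|z - x - d|]distrC opprB addrA [d + x]addrC [`|z - x|]distrC.
have := convex_ge_tangent f_grad x z f_convex.
have := descent_lemma dot_norm f_grad x d grad_lip.
have := ler_wpM2r (sqr_ge0 `|d|) LM.
lra.
Qed.

End proximal_step.

(** * Monotone sequences dominated by telescoping differences *)

Lemma cvg_half_infty : k./2 @[k --> \oo] --> \oo.
Proof.
apply/cvgnyPge => A; exists A.*2 => // k /= Ak.
by rewrite -[A]doubleK half_leq.
Qed.

Section summable_monotone.
Context {R : realType} (e r : nat -> R).
Hypothesis e_ge0 : forall k, 0 <= e k.
Hypothesis e_nonincreasing : forall k, e k.+1 <= e k.
Hypothesis r_ge0 : forall k, 0 <= r k.
Hypothesis e_le_telescope : forall k, e k <= r k - r k.+1.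

(** Each of the [n + 1] terms from [e m] to [e (m + n)] is at least the last one, and their sum
    telescopes. *)
Lemma telescope_monotone_bound m n :
  n.+1%:R * e (m + n)%N <= r m - r (m + n).+1.
Proof.
elim: n => [|n IHn]; first by rewrite addn0 mul1r.
rewrite addnS -natr1 mulrDl mul1r.
have := e_le_telescope (m + n).+1.
have := ler_wpM2l (ler0n R n.+1) (e_nonincreasing (m + n)).
lra.
Qed.

Lemma cvg_mul_index0 : (fun k => k.+1%:R * e k) @ \oo --> (0 : R).
Proof.
have /cvg_ex[l rl] : cvg (r @ \oo).
  apply: nonincreasing_is_cvgn.
    apply/nonincreasing_seqP => k.
    by rewrite -subr_ge0; apply: le_trans (e_le_telescope k).
  by exists 0 => _ [k _ <-].
have r_half : r k./2 @[k --> \oo] --> l by exact: cvg_comp cvg_half_infty rl.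
have rS : r k.+1 @[k --> \oo] --> l by rewrite cvg_shiftS.
have ub : 2 * (r k./2 - r k.+1) @[k --> \oo] --> (0 : R).
  rewrite -(mulr0 2) -(subrr l).
  by apply: cvgM; [exact: cvg_cst|exact: cvgB].
apply: squeeze_cvgr (cvg_cst 0) ub.
near=> k; rewrite mulr_ge0//=.
(* The window from [k./2] to [k] has [uphalf k + 1] terms, and twice that number is at least
   [k + 1]. *)
have := telescope_monotone_bound k./2 (uphalf k).
have -> : (k./2 + uphalf k)%N = k.
  by rewrite uphalf_half addnCA addnn odd_double_half.
rewrite -(ler_pM2l (ltr0n R 2)) => /(le_trans _); apply.
rewrite mulrA ler_wpM2r// -natrM ler_nat.
by rewrite mul2n -ltn_half_double ltnS uphalf_half leq_addl.
Unshelve. all: by end_near. Qed.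

End summable_monotone.

Theorem theorem4 (R : realType) (X : normedModType R)
    (dot : {dot X for idfun}) (hdot : induces_norm dot)
    (L : R) (hL : 0 < L)
    (f : X -> R) (grad : X -> X)
    (f_convex : convex_function setT f)
    (f_diff : lipschitz_differentiable dot L f grad)
    (psi : X -> \bar R)
    (psi_convex : convex_efun psi)
    (psi_proper : proper_efun psi)
    (psi_closed : closed_efun psi)
    (psi_prox : prox_solvable psi)
    (F : X -> \bar R) (hF : forall z, F z = ((f z)%:E + psi z)%E)
    (hOmega : argmin F !=set0)
    (Fstar : \bar R) (hFstar : is_min F Fstar)
    (Lbar : R) (hLbar : L <= Lbar)
    (x0 : X) (x d : nat -> X)
    (hx : proximal_gradient dot grad psi Lbar x0 x d) :
  (fun k : nat => k%:R%:E * (F (x k) - Fstar))%E @ \oo --> 0%E.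
Proof.
have [psiNoo [y psiy]] := psi_proper.
have [[z _ Fz] Fstar_lb] := hFstar.
have [_ xS d_min] := hx.
have Lbar0 : 0 <= Lbar by rewrite (le_trans (ltW hL)).
have psiz : psi z \is a fin_num.
  have : (F z <= F y)%E by rewrite Fz; apply: Fstar_lb; exists y.
  rewrite !hF fin_numE psiNoo/=; move: (psiNoo z) psiy (psiNoo y).
  by case: (psi z) => //; case: (psi y).
have psix k : psi (x k.+1) \is a fin_num.
  rewrite xS; apply: (argmin_prox_fin_num (w := z - x k) psiNoo (d_min k)).
  by rewrite addrCA subrr addr0.
(* The index starts at [x 1]: [psi] may be [+oo] at [x 0], whereas every later iterate lies in the
   domain of [psi]. *)
pose G k := f (x k.+1) + fine (psi (x k.+1)).
pose m := f z + fine (psi z).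
have FxE k : F (x k.+1) = (G k)%:E by rewrite hF EFinD fineK.
have FstarE : Fstar = m%:E by rewrite -Fz hF EFinD fineK.
have step k w : psi w \is a fin_num ->
    G k + Lbar / 2 * `|x k.+1 - w| ^+ 2 <=
    f w + fine (psi w) + Lbar / 2 * `|x k - w| ^+ 2.
  move=> psiw; rewrite /G xS.
  by apply: (prox_gradient_decrease hdot psi_convex Lbar0 hLbar f_convex f_diff
    (d_min k)); rewrite ?fineK// -xS.
rewrite -cvg_shiftS.
have -> : (fun k => k.+1%:R%:E * (F (x k.+1) - Fstar))%E =
          (fun k => (k.+1%:R * (G k - m))%:E).
  by apply/funext => k; rewrite FxE FstarE -EFinB -EFinM.
apply: cvg_EFin; first exact: nearW.
apply: (@cvg_mul_index0 _ (fun k => G k - m)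
  (fun k => Lbar / 2 * `|x k - z| ^+ 2)) => k.
- by rewrite subr_ge0 -lee_fin -FxE -FstarE; apply: Fstar_lb; exists (x k.+1).
(* Monotonicity of the gaps: the competitor is the current iterate itself, so its distance term
   vanishes. *)
- have := step k.+1 _ (psix k); rewrite subrr normr0 expr0n/= mulr0 addr0.
  have : 0 <= Lbar / 2 * `|x k.+2 - x k.+1| ^+ 2.
    by rewrite mulr_ge0 ?divr_ge0 ?sqr_ge0.
  rewrite -/(G k); lra.
- by rewrite mulr_ge0 ?divr_ge0 ?sqr_ge0.
- have := step k _ psiz; rewrite -/m; lra.
Qed.
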